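(* Let $\{X_k\}_{k\in\mathbb{N}}$ be a sequence of compact metric spaces and, for each $k$, let $G_k$ be a closed subgroup of $\mathrm{Isom}(X_k)$. Let $X$ be a compact metric space and $G$ a closed subgroup of $\mathrm{Isom}(X)$. Assume that triples $(f_k,\theta_k,\psi_k)$ witness the convergence $(X_k,G_k)\rightarrow_{eGH}(X,G)$. If $G$ is a euclidean neighborhood retract (ENR), then the maps $\theta_k\colon G_k\to G$ may be taken to be continuous; that is, for all sufficiently large $k$ there are continuous maps $\theta_k'\colon G_k\to G$ such that the triples $(f_k,\theta_k',\psi_k)$ also witness the convergence $(X_k,G_k)\rightarrow_{eGH}(X,G)$.
   Context: For a compact metric space $X$, $\mathrm{Isom}(X)$ is its isometry group, with the compact-open topology (equivalently, the topology of the uniform metric $\sup_{x\in X} d_X(gx,hx)$). The groups $G_k$ and $G$ carry the subspace topologies. A space is a euclidean neighborhood retract (ENR) if it is homeomorphic to a subspace of some $\mathbb{R}^q$ that is a retract of a neighborhood of itself in $\mathbb{R}^q$. For $\epsilon\ge 0$ and maps $u,v\colon X\to Y$ into a metric space $(Y,d_Y)$, ''$u=v$ up to $\epsilon$'' means $d_Y(u(x),v(x))\le\epsilon$ for all $x\in X$. A (not necessarily continuous) map $f\colon X\to Y$ of metric spaces is an $\epsilon$-isometry (Gromov--Hausdorff approximation of order $\epsilon$) if $|d_Y(f(x),f(x'))-d_X(x,x')|\le\epsilon$ for all $x,x'\in X$ and for every $y\in Y$ there is $x\in X$ with $d_Y(f(x),y)\le\epsilon$. Let $X,Y$ be compact metric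 spaces and $G_X\le\mathrm{Isom}(X)$, $G_Y\le\mathrm{Isom}(Y)$ closed subgroups. An $\epsilon$-equivariant Gromov--Hausdorff approximation ($\epsilon>0$) between $(X,G_X)$ and $(Y,G_Y)$ is a triple of maps $(f\colon X\to Y,\ \theta\colon G_X\to G_Y,\ \psi\colon G_Y\to G_X)$ such that (1) $f$ is an $\epsilon$-isometry; (2) $\theta(\gamma)\circ f=f\circ\gamma$ up to $\epsilon$ for every $\gamma\in G_X$; (3) $\lambda\circ f=f\circ\psi(\lambda)$ up to $\epsilon$ for every $\lambda\in G_Y$. The maps $f,\theta,\psi$ need not be continuous and $\theta,\psi$ need not be homomorphisms. $(X_k,G_k)\rightarrow_{eGH}(X,G)$ means: for every $\epsilon>0$ there is $N$ such that for all $k\ge N$ there is an $\epsilon$-equivariant Gromov--Hausdorff approximation between $(X_k,G_k)$ and $(X,G)$. Triples $(f_k,\theta_k,\psi_k)$ (defined for all sufficiently large $k$) witness this convergence if each $(f_k,\theta_k,\psi_k)$ is an $\epsilon_k$-equivariant Gromov--Hausdorff approximation between $(X_k,G_k)$ and $(X,G)$ for some positive numbers $\epsilon_k\to 0$. *)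

(* Defs.v *)
From HB Require Import structures.
From mathcomp Require Import all_boot all_order all_algebra.
From mathcomp Require Import all_classical all_reals topology normedtype.

Set Implicit Arguments.
Unset Strict Implicit.
Unset Printing Implicit Defensive.

Import Order.TTheory GRing.Theory Num.Theory.
Import numFieldNormedType.Exports.

Local Open Scope classical_set_scope.
Local Open Scope ring_scope.

(* Any set [A : set T] coerces to the type of its elements, which carries the
   subspace topology when [T] is a topological space. *)

Definition homeomorphic (S T : topologicalType) : Prop :=
  exists (h : S -> T) (h' : T -> S),
    [/\ continuous h, continuous h', cancel h h' & cancel h' h].

Definition neighborhood_retract (T : topologicalType) (A : set T) : Prop :=
  exists (U : set T) (r : T -> T),
    [/\ A `<=` U°, {within U, continuous r}, r @` U `<=` A
      & forall a, A a -> r a = a].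

Definition euclidean_neighborhood_retract (R : realType) (T : topologicalType) :
    Prop :=
  exists (q : nat) (A : set 'rV[R]_q),
    homeomorphic T A /\ neighborhood_retract A.

Section EquivariantGromovHausdorff.
Context {R : realType}.
Implicit Types X Y : metricType R.

(* [{compact-open, X -> X}] contains all functions, continuous or not; on
   compact [X], its topology restricted to isometries is that of the uniform
   metric. *)
Definition isometry_group X : set {compact-open, X -> X} :=
  [set g | (forall x y, mdist (g x) (g y) = mdist x y) /\
           (forall y, exists x, g x = y)].
Arguments isometry_group : clear implicits.

Definition closed_isometry_subgroup X (G : set {compact-open, X -> X}) : Prop :=
  [/\ G `<=` isometry_group X,
      closed (set_val @^-1` G : set (isometry_group X)),
      G (fun x => x),
      forall g h : X -> X, G g -> G h -> G (g \o h)
    & forall g h : X -> X, G g -> cancel g h -> cancel h g -> G h].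

Definition isometry_fun X (G : set {compact-open, X -> X}) (g : G) : X -> X :=
  set_val g.

Definition eq_up_to (S : Type) Y (e : R) (u v : S -> Y) : Prop :=
  forall x, mdist (u x) (v x) <= e.

Definition eps_isometry X Y (e : R) (f : X -> Y) : Prop :=
  (forall x x', `|mdist (f x) (f x') - mdist x x'| <= e) /\
  (forall y, exists x, mdist (f x) y <= e).

Definition eGH_approximation X Y
    (GX : set {compact-open, X -> X}) (GY : set {compact-open, Y -> Y})
    (e : R) (f : X -> Y) (theta : GX -> GY) (psi : GY -> GX) : Prop :=
  [/\ 0 < e,
      eps_isometry e f,
      forall g : GX, eq_up_to e (isometry_fun (theta g) \o f)
                                (f \o isometry_fun g)
    & forall l : GY, eq_up_to e (isometry_fun l \o f)
                                (f \o isometry_fun (psi l))].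

Definition eGH_converges
    (X_ : nat -> metricType R) (G_ : forall k, set {compact-open, X_ k -> X_ k})
    X (G : set {compact-open, X -> X}) : Prop :=
  forall e : R, 0 < e -> exists N : nat, forall k, (N <= k)%N ->
    exists (f : X_ k -> X) (theta : G_ k -> G) (psi : G -> G_ k),
      eGH_approximation e f theta psi.

(* The triples exist only from the index [N] on, hence the dependency on a
   proof of [N <= k]: for small [k] there may be no map at all from [X_ k] to
   [X] (when [X] is empty). *)
Definition witness_eGH_converges
    (X_ : nat -> metricType R) (G_ : forall k, set {compact-open, X_ k -> X_ k})
    X (G : set {compact-open, X -> X}) (N : nat)
    (f : forall k, (N <= k)%N -> X_ k -> X)
    (theta : forall k, (N <= k)%N -> G_ k -> G)
    (psi : forall k, (N <= k)%N -> G -> G_ k) : Prop :=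
  exists e : nat -> R, e @ \oo --> 0 /\
    forall k (Nk : (N <= k)%N),
      eGH_approximation (e k) (f k Nk) (theta k Nk) (psi k Nk).

Lemma eGH_approximation_le X Y
    (GX : set {compact-open, X -> X}) (GY : set {compact-open, Y -> Y})
    (e e' : R) (f : X -> Y) (theta : GX -> GY) (psi : GY -> GX) :
  e <= e' -> eGH_approximation e f theta psi ->
  eGH_approximation e' f theta psi.
Proof.
move=> ee' [e0 [fd fs] ft fp]; split.
- exact: lt_le_trans ee'.
- split=> [x x'|y]; first exact: le_trans (fd x x') ee'.
  by have [x fx] := fs y; exists x; exact: le_trans ee'.
- by move=> g x; exact: le_trans (ft g x) ee'.
- by move=> l x; exact: le_trans (fp l x) ee'.
Qed.

Lemma witness_eGH_convergesW
    (X_ : nat -> metricType R) (G_ : forall k, set {compact-open, X_ k -> X_ k})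
    X (G : set {compact-open, X -> X}) (N : nat)
    (f : forall k, (N <= k)%N -> X_ k -> X)
    (theta : forall k, (N <= k)%N -> G_ k -> G)
    (psi : forall k, (N <= k)%N -> G -> G_ k) :
  witness_eGH_converges f theta psi -> eGH_converges G_ G.
Proof.
move=> [e [e0 fe]] d d0.
have /cvgrPdist_le/(_ _ d0)[M _ Md] := e0.
exists (maxn N M) => k; rewrite geq_max => /andP[Nk Mk].
exists (f k Nk), (theta k Nk), (psi k Nk).
apply: eGH_approximation_le (fe k Nk).
by have := Md k Mk; rewrite /= sub0r normrN; exact: le_trans (ler_norm _).
Qed.

End EquivariantGromovHausdorff.

(* Main.v *)
Require Import Defs.
From HB Require Import structures.
From mathcomp Require Import all_boot all_order all_algebra.
From mathcomp Require Import all_classical all_reals topology normedtype.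
From mathcomp Require Import interval_inference lra.

Set Implicit Arguments.
Unset Strict Implicit.
Unset Printing Implicit Defensive.

Import Order.TTheory GRing.Theory Num.Theory.
Import numFieldNormedType.Exports.

Local Open Scope classical_set_scope.
Local Open Scope ring_scope.

(** Almost equivariance makes each [theta k] almost continuous. If [g] and [h] in
    [G_ k] are uniformly close, then so are [f \o g] and [f \o h], hence
    [theta g \o f] and [theta h \o f], hence [theta g] and [theta h] because the
    image of [f] is almost dense ([eGH_oscillation]). It remains to replace a
    map with small oscillation by a nearby continuous one.

    For maps into a normed space a partition of unity does this
    ([small_oscillation_continuous]). For maps into [G], embed [G] into a
    euclidean space, average there, and return by the retraction
    ([ENR_continuous_approximation]). This needs a tube of uniform width around
    the embedded group on which the retraction is defined and moves points
    little, and uniform continuity of the embedding; both come from compactness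
    of [G], an instance of the Arzela-Ascoli theorem
    ([closed_isometry_subgroup_compact]).

    So for every [e > 0] and all large [k] there is a continuous map within [e]
    of [theta k]; changing [theta k] by [e] costs only [e] in the quality of the
    approximation ([eGH_approximation_perturb]), and a diagonal choice
    ([vanishing_bounds]) lets [e] tend to 0 with [k]. *)

(** * The topology of a group of isometries of a compact space *)

Lemma ultra_fmap (S T : Type) (f : S -> T) (F : set_system S) :
  UltraFilter F -> UltraFilter (f @ F).
Proof.
move=> FU; split; first exact: fmap_proper_filter.
move=> G GF FG; apply/seteqP; split=> A //; last exact: FG.
have [//|FA GA] := in_ultra_setVsetC (f @^-1` A) FU.
have GnA : G (~` A) := FG _ FA.
by have [x []] := filter_ex (filterI GA GnA).
Qed.

Section Isometries.
Import metricType_numDomainType.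
Context {R : realType} {X : metricType R}.
Implicit Types G : set {compact-open, X -> X}.

Definition isometric (g : X -> X) := forall x y, mdist (g x) (g y) = mdist x y.

Lemma isometry_fun_isometric G (g : G) : G `<=` @isometry_group R X ->
  isometric (isometry_fun g).
Proof. by move=> GI; have [] := GI _ (set_valP g). Qed.

(** Isometries are equicontinuous, so a neighborhood of [x] on which [g] and all
    [u i] move little turns closeness at [x] into closeness around [x], and
    finitely many such neighborhoods cover [X]. *)
Lemma pointwise_cvg_uniform I (F : set_system I) (u : I -> X -> X) (g : X -> X) :
  compact [set: X] -> Filter F -> (forall i, isometric (u i)) -> isometric g ->
  (forall x, u ^~ x @ F --> g x) ->
  forall e : R, 0 < e -> \forall i \near F, forall x, mdist (g x) (u i x) <= e.
Proof.
move=> /compact_near_coveringP Xco FF uI gI ug e e0.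
apply: filterS (Xco I F (fun i x => mdist (g x) (u i x) <= e) FF _) => [i|x _].
  by move=> + x; exact.
have e3 : 0 < e / 3 by rewrite divr_gt0.
exists (ball x (e / 3), [set i | mdist (g x) (u i x) <= e / 3]); first split.
- exact: nbhsx_ballx.
- exact: (cvgrPdist_le _ _).1 (ug x) _ e3.
move=> [y i]; rewrite ballEmdist/= => -[xy gu].
have := metric_triangle (g y) (g x) (u i y).
have := metric_triangle (g x) (u i x) (u i y).
rewrite uI gI (metric_sym y); lra.
Qed.

(** Around each point of a compact [K] the limit [g] keeps a margin to the
    complement of an open [O] containing [g K], and so do the maps uniformly
    close to [g]; finitely many of these points suffice. *)
Lemma uniform_cvg_compact_open I (F : set_system I)
    (u : I -> {compact-open, X -> X}) (g : {compact-open, X -> X}) :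
  Filter F -> isometric g ->
  (forall e : R, 0 < e -> \forall i \near F, forall x, mdist (g x) (u i x) <= e) ->
  u @ F --> g.
Proof.
move=> FF gI ug; apply/compact_open_cvgP => K O Kco oO gKO.
move/compact_near_coveringP/near_covering_withinP : Kco => Kco.
apply: filterS (Kco I F (fun i x => O (u i x)) FF _) => [i KO _ [x Kx <-]|x Kx].
  exact: KO.
have /nbhs_mdistP[r /= r0 rO] : nbhs (g x) O.
  by apply: open_nbhs_nbhs; split => //; apply: gKO; exists x.
have r2 : 0 < r / 2 by rewrite divr_gt0.
exists (ball x (r / 2), [set i | forall x, mdist (g x) (u i x) <= r / 2]).
  by split; [exact: nbhsx_ballx|exact: ug].
move=> [y i]; rewrite ballEmdist/= => -[xy /(_ y) gu] _; apply: rO => /=.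
have := metric_triangle (g x) (g y) (u i y); rewrite gI; lra.
Qed.

(** The same in the subspace topology of a set of maps: a way to recognize
    neighborhoods of [g] in [G] by uniform closeness. *)
Lemma uniform_cvg_isometry_fun G I (F : set_system I) (u : I -> G) (g : G) :
  Filter F -> isometric (isometry_fun g) ->
  (forall e : R, 0 < e -> \forall i \near F,
    forall x, mdist (isometry_fun g x) (isometry_fun (u i) x) <= e) ->
  u @ F --> g.
Proof.
move=> FF gI ug A /= [_ [[B oB <-] Bg] /filterS]; apply.
have /(_ B) := @uniform_cvg_compact_open I F (fun i => isometry_fun (u i))
  (isometry_fun g) FF gI ug.
by apply; exact: open_nbhs_nbhs.
Qed.

Lemma evaluation_continuous G (x : X) :
  continuous (fun g : G => isometry_fun g x).
Proof.
apply/continuousP => O oO.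
exists [set g | g @` [set x] `<=` O].
  by apply: compact_open_open oO; exact: compact_set1.
by apply/seteqP; split => g /=; [apply; exists x|move=> Og _ [_ -> <-]].
Qed.

(** Together with [uniform_cvg_isometry_fun], this says that the topology of a
    set of isometries is that of uniform convergence. *)
Lemma near_uniform G (g : G) : compact [set: X] -> G `<=` @isometry_group R X ->
  forall e : R, 0 < e -> \forall h \near g,
    forall x, mdist (isometry_fun g x) (isometry_fun h x) <= e.
Proof.
move=> Xco GI; have uI (h : G) := isometry_fun_isometric h GI.
have := @pointwise_cvg_uniform _ (nbhs g) (fun h => isometry_fun h)
  (isometry_fun g) Xco _ uI (uI g).
by apply=> x; exact: evaluation_continuous.
Qed.

(** A dense image is everything, because a compact image is closed. *)
Lemma compact_isometric_surj (g : X -> X) : compact [set: X] -> isometric g ->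
  (forall (e : R) y, 0 < e -> exists x, mdist (g x) y <= e) ->
  forall y, exists x, g x = y.
Proof.
move=> Xco gI gd y.
have gc : continuous g.
  by move=> x; apply/cvgrPdist_lt => e e0; near=> z;
    rewrite gI; near: z; apply: (cvgr_dist_lt (f := id)).
have [x _ <-] : (g @` [set: X]) y; last by exists x.
apply: (compact_closed (@metric_hausdorff _ X)).
  by apply: continuous_compact Xco; exact: continuous_subspaceT.
move=> B /nbhs_mdistP[r /= r0 rB].
have [x gx] := gd (r / 2) y (divr_gt0 r0 (ltr0n _ 2)).
exists (g x); split; first by exists x.
by apply: rB; rewrite /= metric_sym; lra.
Unshelve. all: by end_near. Qed.

(** The Arzela-Ascoli argument for isometries: an ultrafilter on [G] converges
    at every point of the compact space [X]; the pointwise limit is isometric,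
    so the convergence is uniform; hence the limit is onto, therefore an
    isometry, and it lies in [G] because [G] is closed among isometries. *)
Lemma closed_isometry_subgroup_compact G :
  compact [set: X] -> closed_isometry_subgroup G -> compact [set: G].
Proof.
move=> Xco [GI Gc _ _ _]; rewrite compact_ultra => F FU _.
have uI (h : G) := isometry_fun_isometric h GI.
have evF (x : X) : exists y : X, (fun h : G => isometry_fun h x) @ F --> y.
  have := Xco; rewrite compact_ultra => Xu.
  have [y [_ Fy]] := Xu ((fun h : G => isometry_fun h x) @ F)
    (ultra_fmap _ FU) filterT.
  by exists y.
have [g ug] := choice evF.
have gI : isometric g.
  move=> x y; apply: subr0_eq; apply: normr0_eq0; apply/eqP.
  rewrite eq_le normr_ge0 andbT; apply/ler_addgt0Pr => e e0.
  have e2 : 0 < e / 2 by rewrite divr_gt0.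
  have [h [gx gy]] := @filter_ex _ F _ _
    (filterI (cvgr_dist_le (ug x) e2) (cvgr_dist_le (ug y) e2)).
  have := metric_triangle (g x) (isometry_fun h x) (g y).
  have := metric_triangle (isometry_fun h x) (isometry_fun h y) (g y).
  have := metric_triangle (isometry_fun h x) (g x) (isometry_fun h y).
  have := metric_triangle (g x) (g y) (isometry_fun h y).
  rewrite uI (metric_sym _ (g x)) (metric_sym (isometry_fun h y) (g y)).
  by move: gx gy => /=; rewrite add0r ler_norml => *; apply/andP; split; lra.
have FF : ProperFilter F by exact: ultra_proper.
have gu := pointwise_cvg_uniform Xco FF uI gI ug.
have gisom : @isometry_group R X g.
  split => //; apply: compact_isometric_surj => // e y e0.
  have [h hg] := @filter_ex _ F _ _ (gu _ e0).
  have [_ /(_ y)[x <-]] := GI _ (set_valP h).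
  by exists x; exact: hg.
pose g' : @isometry_group R X := SigSub (mem_set gisom).
pose inc (h : G) : @isometry_group R X := SigSub (mem_set (GI _ (set_valP h))).
have Gg : G g.
  suff : (set_val @^-1` G : set (@isometry_group R X)) g' by [].
  apply: (@closed_cvg _ _ F _ inc _ Gc _ g').
    by apply: nearW => h; exact: (set_valP h).
  exact: uniform_cvg_isometry_fun.
exists (SigSub (mem_set Gg)); split => //.
exact: (@uniform_cvg_isometry_fun G G F id).
Qed.

End Isometries.

(** * Continuous approximation of maps with small oscillation *)

Section MetricSpaces.
Context {R : realType} {X : metricType R}.
Import metricType_numDomainType.

Lemma mdist_continuous (y : X) :
  continuous (fun x => mdist x y).
Proof.
move=> x; apply/(@cvgrPdist_le _ R^o) => e e0; near=> z.
have xz : mdist x z < e by near: z; apply: (cvgr_dist_lt (f := id)).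
have := metric_triangle x z y; have := metric_triangle z x y.
rewrite (metric_sym z x) ler_norml => *; apply/andP; split; lra.
Unshelve. all: by end_near. Qed.

Lemma finite_net (e : R) :
  compact [set: X] -> 0 < e ->
  exists (n : nat) (c : 'I_n -> X), forall x, exists i, mdist x (c i) < e.
Proof.
move=> /compact_near_coveringP Xco e0.
(* Filter of the finite families of centers, directed by inclusion. *)
pose F : set_system (seq X) :=
  filter_from setT (fun s : seq X => [set s' : seq X | {subset s <= s'}]).
have FF : Filter F.
  apply: filter_from_filter; first by exists [::].
  move=> s t _ _; exists (s ++ t) => // w stw.
  by split=> x xs; apply: stw; rewrite mem_cat xs ?orbT.
have [|s _ /(_ s (fun _ => id)) sX] :=
  Xco _ F (fun s x => exists2 y, y \in s & mdist x y < e) FF.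
  move=> x _; exists (ball x e, [set s : seq X | x \in s]).
    split; first exact: nbhsx_ballx.
    by exists [:: x] => // s; apply; rewrite mem_head.
  move=> [y s]; rewrite ballEmdist /= metric_sym => -[xy xs].
  by exists x.
exists _, (tnth (in_tuple s)) => x; have [y ys xy] := sX x I.
by have /tnthP[i yi] : y \in in_tuple s; [exact: ys|exists i; rewrite -yi].
Qed.

End MetricSpaces.

Section SmallOscillation.
Context {R : realType} {X : metricType R} {V : normedModType R}.

(** A partition of unity glues values of [u]. Take a finite [e / 4]-net [c] of
    [X]. Recording, for each [i], some [j] with [g (c i)] close to [c j] sorts the
    isometries into finitely many classes [a], indexed by maps of the net to
    itself, and two isometries of one class differ by at most [e]. The weight
    [phi a g], a product of continuous bumps, is nonzero only on class [a], and
    the weights do not all vanish at [g]; averaging one value of [u] per class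
    with these weights gives [v]. *)
Lemma small_oscillation_continuous (G : set {compact-open, X -> X})
    (u : G -> V) (e r : R) :
  compact [set: X] -> G `<=` @isometry_group R X -> 0 < e ->
  (forall g h : G,
    (forall x, mdist (isometry_fun g x) (isometry_fun h x) <= e) ->
    `|u g - u h| <= r) ->
  exists2 v : G -> V, continuous v & forall g, `|v g - u g| <= r.
Proof.
move=> Xco GI e0 uosc.
have gI (g : G) := isometry_fun_isometric g GI.
have e4 : 0 < e / 4 by rewrite divr_gt0.
have [n [c cX]] := finite_net Xco e4.
pose bump (i j : 'I_n) (g : G) : R :=
  Num.max 0 (e / 4 - mdist (isometry_fun g (c i)) (c j)).
pose phi (a : {ffun 'I_n -> 'I_n}) g := \prod_i bump i (a i) g.
have bump0 i j g : 0 <= bump i j g by rewrite le_max lexx.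
have phi0 a g : 0 <= phi a g by apply: prodr_ge0.
have phi_close a g h : phi a g != 0 -> phi a h != 0 ->
    forall x, mdist (isometry_fun g x) (isometry_fun h x) <= e.
  have near_c k i : phi a k != 0 ->
      mdist (isometry_fun k (c i)) (c (a i)) < e / 4.
    move/prodf_neq0/(_ i isT); rewrite /bump; apply: contra_neqT.
    by rewrite -leNgt => ?; apply/max_idPl; rewrite subr_le0.
  move=> ag ah x; have [i xi] := cX x.
  have := near_c g i ag; have := near_c h i ah.
  have := metric_triangle (isometry_fun g x) (isometry_fun g (c i))
    (isometry_fun h x).
  have := metric_triangle (isometry_fun g (c i)) (c (a i)) (isometry_fun h x).
  have := metric_triangle (c (a i)) (isometry_fun h (c i)) (isometry_fun h x).
  rewrite !gI (metric_sym (c i) x) (metric_sym (c (a i)) (isometry_fun h (c i))).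
  lra.
pose S g := \sum_a phi a g.
have S0 g : 0 < S g.
  (* The sum over all classes factors as the product over [i] of the sums of
     bumps over [j], and each factor is positive since [c] is a net. *)
  rewrite /S -(bigA_distr_bigA (fun i j => bump i j g)); apply: prodr_gt0 => i _.
  have [j ij] := cX (isometry_fun g (c i)).
  rewrite (bigD1 j)//= ltr_pwDl ?sumr_ge0// /bump lt_max subr_gt0 ij orbT//.
(* An empty class gets the value 0, which always has weight 0. *)
have [t tP] : exists t : {ffun 'I_n -> 'I_n} -> V,
    forall a g, phi a g != 0 -> `|t a - u g| <= r.
  suff tex a : exists v, forall g, phi a g != 0 -> `|v - u g| <= r.
    by have [t tP] := choice tex; exists t.
  have [[h ah]|noh] := pselect (exists h, phi a h != 0).
    by exists (u h) => g ag; apply: uosc => x; exact: phi_close ah ag x.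
  by exists 0 => g ag; case: noh; exists g.
have bump_cont i j : continuous (bump i j).
  move=> g; apply: (@continuous_max R G (fun=> 0)); first exact: cst_continuous.
  apply: (@continuousB R R^o G (fun=> e / 4)); first exact: cst_continuous.
  apply: (@continuous_comp _ _ _ (fun g => isometry_fun g (c i)) (mdist^~ (c j))).
    exact: evaluation_continuous.
  exact: mdist_continuous.
have phi_cont a : continuous (phi a).
  by apply: (continuous_big (@mul_continuous R)) => i _; exact: bump_cont.
have S_cont : continuous S.
  rewrite /S; apply: (continuous_big (@add_continuous R^o)) => a _.
  exact: phi_cont.
exists (fun g => (S g)^-1 *: \sum_a phi a g *: t a).
  have num_cont : continuous (fun g => \sum_a phi a g *: t a).
    apply: (continuous_big (@add_continuous V)) => a _ g.
    by apply: continuousZr_tmp; exact: (phi_cont a g).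
  move=> g; apply: (@continuousZ R V G (fun g => (S g)^-1) _ g _ (num_cont g)).
  by apply: continuousV; [rewrite gt_eqF|exact: S_cont].
move=> g; have -> : u g = (S g)^-1 *: \sum_a phi a g *: u g.
  by rewrite -scaler_suml scalerA mulVf ?scale1r// gt_eqF.
rewrite -scalerBr normrZ gtr0_norm ?invr_gt0// mulrC ler_pdivrMr//.
rewrite -sumrB mulr_sumr; apply: le_trans (ler_norm_sum _ _ _) _.
apply: ler_sum => a _; rewrite -scalerBr normrZ ger0_norm// mulrC.
have [->|ag] := eqVneq (phi a g) 0; first by rewrite !mulr0.
by rewrite ler_wpM2r// tP.
Qed.

End SmallOscillation.

(** * Retractions onto a group of isometries *)

(** The form in which the retract hypothesis is used: [T] embeds by [i] into an
    open set [W] of a euclidean space, and [p], the retraction followed by the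
    inverse of the embedding, maps [W] back. Outside [W] the map [p] takes the
    junk value [t0] where the retraction leaves the image of [i]. *)
Lemma ENR_retraction (R : realType) (T : topologicalType) (t0 : T) :
  euclidean_neighborhood_retract R T ->
  exists (q : nat) (i : T -> 'rV[R]_q) (W : set 'rV[R]_q) (p : 'rV[R]_q -> T),
    [/\ continuous i, open W, forall v, W v -> {for v, continuous p}
      & forall t, W (i t) /\ p (i t) = t].
Proof.
move=> [q [A [[h [h' [hc h'c hK h'K]]] [U [r [AU rc rA rK]]]]]].
pose p v := if pselect (A (r v)) is left Av then h' (SigSub (mem_set Av)) else t0.
exists q, (fun t => set_val (h t)), U°, p.
have Ah t : A (set_val (h t)) by exact: (set_valP (h t)).
split.
- move=> t; apply: continuous_comp; first exact: hc.
  exact: initial_continuous.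
- exact: open_interior.
- move=> v Uv N; rewrite /p.
  have ArU w : U w -> A (r w) by move=> Uw; apply: rA; exists w.
  case: pselect => [Av|]; last by case; apply: ArU; exact: interior_subset.
  move=> /h'c[_ [[B oB <-] Brv sBN]].
  have rv : {for v, continuous r}.
    by have := rc v; rewrite /continuous_at -(nbhs_subspace_interior Uv).
  have rB : \forall w \near v, B (r w) by apply: rv; exact: open_nbhs_nbhs.
  suff : \forall w \near v, N (p w) by [].
  near=> w.
  have Uw : U w by near: w; exact: Uv.
  have Bw : B (r w) by near: w; exact: rB.
  rewrite /p; case: pselect => [Aw|]; last by case; exact: ArU.
  exact: sBN.
- move=> t; split; first exact: AU.
  rewrite /p rK//; case: pselect => // At.
  by rewrite -[RHS]hK; congr h'; apply/val_inj.
Unshelve. all: by end_near. Qed.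

Section Moduli.
Context {R : realType} {X : metricType R} {V : normedModType R}.
Context (G : set {compact-open, X -> X}).
Hypotheses (Xco : compact [set: X]) (Gclosed : closed_isometry_subgroup G).

Let GI : G `<=` @isometry_group R X. Proof. by case: Gclosed. Qed.

Let gI (g : G) : isometric (isometry_fun g).
Proof. exact: isometry_fun_isometric. Qed.

Let Gco : near_covering [set: G].
Proof.
by apply/compact_near_coveringP; exact: closed_isometry_subgroup_compact.
Qed.

(** Uniform continuity on the compact group [G], for the uniform distance. *)
Lemma continuous_modulus (i : G -> V) (r : R) : continuous i -> 0 < r ->
  exists2 d : R, 0 < d & forall g h : G,
    (forall x, mdist (isometry_fun g x) (isometry_fun h x) <= d) ->
    `|i g - i h| <= r.
Proof.
move=> ic r0.
pose close (d : R) (g h : G) :=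
  forall x, mdist (isometry_fun g x) (isometry_fun h x) <= d.
pose good d g := forall h, close d g h -> `|i g - i h| <= r.
suff good0 : \forall d \near 0^'+, setT `<=` good d.
  have [d [dr d0]] :=
    @filter_ex R 0^'+ _ _ (filterI good0 (nbhs_right_gt 0)).
  by exists d => // g h; exact: dr.
apply: Gco => g _.
have r2 : 0 < r / 2 by rewrite divr_gt0.
(* The filter of uniform neighborhoods of [g]. *)
pose F : set_system G :=
  filter_from [set d : R | 0 < d] (fun d => [set h | close d g h]).
have FF : Filter F.
  apply: filter_from_filter; first by exists 1 => /=.
  move=> d d' /= d0 d'0; exists (Num.min d d') => /=; first by rewrite lt_min d0.
  by move=> h gh; split=> x; apply: le_trans (gh x) _; rewrite ge_min lexx ?orbT.
have Fg : F --> g.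
  by apply: (@uniform_cvg_isometry_fun _ _ G G F id) => // d d0; exists d.
have [d /= d0 gd] : F [set h | `|i g - i h| <= r / 2].
  by apply: Fg; exact: (cvgr_dist_le _ _ (ic g) _ r2).
have d2 : 0 < d / 2 by rewrite divr_gt0.
exists ([set k | close (d / 2) g k], [set d' | d' < d / 2]).
  split; first exact: near_uniform.
  exact: nbhs_right_lt.
move=> [k d'] /= [gk d'd] h kh.
have gh : close d g h.
  move=> x; have := metric_triangle (isometry_fun g x) (isometry_fun k x)
    (isometry_fun h x).
  by have := gk x; have := kh x; lra.
have := gd _ gh; have /gd : close d g k by move=> x; have := gk x; lra.
have := ler_distD (i g) (i k) (i h); rewrite (distrC (i k) (i g)) /=; lra.
Qed.

(** By compactness of [G], a tube of some positive radius [r] around [i G] lies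
    in [W], and [p] moves no point of it, within [r] of [i g], further than [e]
    from [g]. *)
Lemma retraction_modulus (i : G -> V) (W : set V) (p : V -> G) (e : R) :
  continuous i -> open W -> (forall v, W v -> {for v, continuous p}) ->
  (forall g, W (i g) /\ p (i g) = g) -> 0 < e ->
  exists2 r : R, 0 < r & forall g v, `|v - i g| <= r ->
    W v /\ forall x, mdist (isometry_fun (p v) x) (isometry_fun g x) <= e.
Proof.
move=> ic oW pc iW e0.
pose close (d : R) (g h : G) :=
  forall x, mdist (isometry_fun g x) (isometry_fun h x) <= d.
pose good r g := forall v, `|v - i g| <= r -> W v /\ close e (p v) g.
suff good0 : \forall r \near 0^'+, setT `<=` good r.
  have [r [gr r0]] :=
    @filter_ex R 0^'+ _ _ (filterI good0 (nbhs_right_gt 0)).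
  by exists r => // g; exact: gr.
apply: Gco => g _.
have e2 : 0 < e / 2 by rewrite divr_gt0.
have [Wg pg] := iW g.
have gnear : \forall h \near g, close (e / 2) g h by exact: near_uniform.
have : \forall v \near i g, W v /\ close (e / 2) g (p v).
  apply: filterI; first exact: open_nbhs_nbhs.
  by apply: (pc _ Wg); rewrite pg.
move=> /nbhs_normP[r /= r0 gr].
have r2 : 0 < r / 2 by rewrite divr_gt0.
exists ([set k | close (e / 2) g k /\ `|i g - i k| < r / 2], [set r' | r' < r / 2]).
  split; last exact: nbhs_right_lt.
  by apply: filterI => //; exact: (cvgr_dist_lt _ _ (ic g) _ r2).
move=> [k r'] /= [[gk igk] r'r] v vk.
have [|Wv gv] := gr v.
  have := ler_distD (i k) (i g) v; rewrite /= (distrC (i k) v); lra.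
split=> // x.
have := metric_triangle (isometry_fun (p v) x) (isometry_fun g x)
  (isometry_fun k x).
by have := gk x; have := gv x;
  rewrite (metric_sym (isometry_fun g x) (isometry_fun (p v) x)); lra.
Qed.

End Moduli.

(** * Approximate equivariance *)

Section Approximation.
Context {R : realType}.

(** Compose [theta] with the embedding of [G] into a euclidean space, replace the
    result by a uniformly close continuous map, and retract back to [G]. The
    bound [d] depends on [G] and [e] only, so that it serves all [Y] at once. *)
Lemma ENR_continuous_approximation (X : metricType R)
    (G : set {compact-open, X -> X}) (e : R) :
  compact [set: X] -> closed_isometry_subgroup G ->
  euclidean_neighborhood_retract R G -> 0 < e ->
  exists2 d : R, 0 < d &
    forall (Y : metricType R) (H : set {compact-open, Y -> Y})
      (theta : H -> G) (s : R),
    compact [set: Y] -> H `<=` @isometry_group R Y -> 0 < s ->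
    (forall g h : H,
      (forall y, mdist (isometry_fun g y) (isometry_fun h y) <= s) ->
      forall x, mdist (isometry_fun (theta g) x) (isometry_fun (theta h) x)
        <= d) ->
    exists2 theta' : H -> G, continuous theta' &
      forall g x, mdist (isometry_fun (theta' g) x) (isometry_fun (theta g) x)
        <= e.
Proof.
move=> Xco Gc GENR e0.
have G1 : G (fun x => x) by case: Gc.
have [q [i [W [p [ic oW pc iW]]]]] :=
  ENR_retraction (SigSub (mem_set G1) : G) GENR.
have [r r0 rW] := retraction_modulus Xco Gc ic oW pc iW e0.
have [d d0 di] := continuous_modulus Xco Gc ic r0.
exists d => // Y H theta s Yco HI s0 osc.
have [c cc cr] := @small_oscillation_continuous _ _ _ H (i \o theta) s r Yco HI s0
  (fun g h gh => di _ _ (osc g h gh)).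
exists (p \o c) => [g|g x]; last by have [_] := rW _ _ (cr g).
by apply: continuous_comp; [exact: cc|apply: pc; have [] := rW _ _ (cr g)].
Qed.

Section Triples.
Context {X Y : metricType R} (GX : set {compact-open, X -> X})
  (GY : set {compact-open, Y -> Y}).
Context (e : R) (f : X -> Y) (theta : GX -> GY) (psi : GY -> GX).
Hypothesis approx : eGH_approximation e f theta psi.

(** The second component of an approximation is almost continuous:
    [theta g \o f] is [f \o g] up to [e], the map [f] distorts distances by at
    most [e], and its image is [e]-dense. *)
Lemma eGH_oscillation (d : R) (g h : GX) : GY `<=` @isometry_group R Y ->
  (forall x, mdist (isometry_fun g x) (isometry_fun h x) <= d) ->
  forall y, mdist (isometry_fun (theta g) y) (isometry_fun (theta h) y)
    <= 5 * e + d.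
Proof.
case: approx => e0 [fI fd] tf _ GI gh y; have [x fxy] := fd y.
have tI (k : GX) := isometry_fun_isometric (theta k) GI.
(* Both steps, from [y] to [f x] and from [theta k (f x)] to [f (k x)], cost
   at most [e]. *)
have move_y (k : GX) :
    mdist (isometry_fun (theta k) y) (f (isometry_fun k x)) <= 2 * e.
  have := metric_triangle (isometry_fun (theta k) y)
    (isometry_fun (theta k) (f x)) (f (isometry_fun k x)).
  by have := tf k x; rewrite tI (metric_sym y) /=; lra.
have := fI (isometry_fun g x) (isometry_fun h x); rewrite ler_norml => /andP[_].
have := gh x; have := move_y g; have := move_y h.
have := metric_triangle (isometry_fun (theta g) y)
  (f (isometry_fun g x)) (isometry_fun (theta h) y).
have := metric_triangle (f (isometry_fun g x)) (f (isometry_fun h x))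
  (isometry_fun (theta h) y).
by rewrite (metric_sym (f (isometry_fun h x)) (isometry_fun (theta h) y)); lra.
Qed.

Lemma eGH_approximation_perturb (d : R) (theta' : GX -> GY) : 0 <= d ->
  (forall g y,
    mdist (isometry_fun (theta' g) y) (isometry_fun (theta g) y) <= d) ->
  eGH_approximation (e + d) f theta' psi.
Proof.
move=> d0 td.
have le_ed : e <= e + d by rewrite lerDl.
have [? ? _ ?] := eGH_approximation_le le_ed approx.
have [_ _ tf _] := approx.
split=> // g x; have := tf g x; have := td g (f x).
have := metric_triangle (isometry_fun (theta' g) (f x))
  (isometry_fun (theta g) (f x)) (f (isometry_fun g x)).
rewrite /=; lra.
Qed.

End Triples.

(** Diagonal choice. The infimum of the admissible bounds at [k] tends to 0 but
    need not be attained, hence the slack [1 / (k + 1)]. *)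
Lemma vanishing_bounds (Q : nat -> R -> Prop) :
  (forall k (e e' : R), e <= e' -> Q k e -> Q k e') ->
  (forall e, 0 < e -> \forall k \near \oo, Q k e) ->
  exists e : nat -> R, [/\ e @ \oo --> 0, forall k, 0 < e k
    & \forall k \near \oo, Q k (e k)].
Proof.
move=> Qmono Qe.
pose E k := [set e : R | 0 < e /\ Q k e].
have E_lb k : lbound (E k) 0 by move=> e [/ltW].
have E_inf k : has_lbound (E k) by exists 0.
have inf0 k : 0 <= inf (E k).
  have [E0|/set0P/negP/negPn/eqP ->] := pselect (E k !=set0); last by rewrite inf0.
  exact: lb_le_inf.
exists (fun k => inf (E k) + k.+1%:R^-1); split.
- apply/cvgrPdist_lt => e e0.
  have e2 : 0 < e / 2 by rewrite divr_gt0.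
  near=> k.
  have : inf (E k) <= e / 2.
    by apply: ge_inf => //; split => //; near: k; exact: Qe.
  have : k.+1%:R^-1 < e / 2 :> R.
    by near: k; exact: near_infty_natSinv_lt (PosNum e2).
  rewrite sub0r normrN ger0_norm ?addr_ge0// => ? ?.
  by rewrite (splitr e) ler_ltD.
- by move=> k; rewrite ltr_wpDl.
- near=> k.
  have Qk1 : Q k 1 by near: k; exact: Qe.
  have Ek : has_inf (E k) by split => //; exists 1.
  have k0 : 0 < k.+1%:R^-1 :> R by [].
  have [e [_ Qke] elt] := inf_adherent k0 Ek.
  exact: Qmono (ltW elt) Qke.
Unshelve. all: by end_near. Qed.

End Approximation.

Theorem theorem3 (R : realType)
    (X_ : nat -> metricType R) (G_ : forall k, set {compact-open, X_ k -> X_ k})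
    (X : metricType R) (G : set {compact-open, X -> X})
    (X_compact : forall k, compact [set: X_ k])
    (G_closed : forall k, closed_isometry_subgroup (G_ k))
    (Xcompact : compact [set: X])
    (Gclosed : closed_isometry_subgroup G)
    (N : nat)
    (f : forall k, (N <= k)%N -> X_ k -> X)
    (theta : forall k, (N <= k)%N -> G_ k -> G)
    (psi : forall k, (N <= k)%N -> G -> G_ k)
    (witness : witness_eGH_converges f theta psi)
    (G_ENR : euclidean_neighborhood_retract R G) :
  exists (N' : nat) (NN' : (N <= N')%N)
         (theta' : forall k, (N' <= k)%N -> G_ k -> G),
    (forall k (N'k : (N' <= k)%N), continuous (theta' k N'k)) /\
    witness_eGH_converges (fun k N'k => f k (leq_trans NN' N'k))
                          theta'
                          (fun k N'k => psi k (leq_trans NN' N'k)).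
Proof.
have [eps [eps0 approx]] := witness.
pose close e k (Nk : (N <= k)%N) (t t' : G_ k -> G) := forall g x,
  mdist (isometry_fun (t' g) x) (isometry_fun (t g) x) <= e.
pose Q k (e : R) := forall Nk : (N <= k)%N, exists theta' : G_ k -> G,
  continuous theta' /\ close e k Nk (theta k Nk) theta'.
have [k e e' ee' Qe Nk|e e0|] := @vanishing_bounds R Q.
- by have [t [tc te]] := Qe Nk; exists t; split => // g x; exact: le_trans ee'.
- have [d d0 dP] := ENR_continuous_approximation Xcompact Gclosed G_ENR e0.
  (* [eGH_oscillation] at scale [eps k] gives oscillation [6 * eps k]. *)
  have d6 : 0 < d / 6 by rewrite divr_gt0.
  have : \forall k \near \oo, eps k < d / 6.
    have /cvgrPdist_lt/(_ _ d6) := eps0; apply: filterS => k.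
    by rewrite sub0r normrN; apply: le_lt_trans; exact: ler_norm.
  apply: filterS => k epsd Nk; have [epsk _ _ _] := approx k Nk.
  have [GI _ _ _ _] := Gclosed; have [GkI _ _ _ _] := G_closed k.
  have epsd' : 5 * eps k + eps k <= d by lra.
  have [t tc te] := dP _ _ (theta k Nk) (eps k) (X_compact k) GkI epsk
    (fun g h gh x => le_trans (eGH_oscillation (approx k Nk) GI gh x) epsd').
  by exists t.
move=> e [e0 epos [M _ MQ]].
pose N' := maxn N M.
have NN' : (N <= N')%N by exact: leq_maxl.
have MN' k : (N' <= k)%N -> (M <= k)%N by exact/leq_trans/leq_maxr.
have tex k (N'k : (N' <= k)%N) := MQ k (MN' k N'k) (leq_trans NN' N'k).
exists N', NN', (fun k N'k => projT1 (cid (tex k N'k))); split.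
  by move=> k N'k; case: cid => t [].
exists (fun k => eps k + e k); split.
  by rewrite -[0]addr0; exact: cvgD.
move=> k N'k; case: cid => t [tc te] /=.
by apply: eGH_approximation_perturb (te) => //; exact: ltW.
Qed.
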